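(* Let $S$, $\geq$, $\mathcal{P}(S)$, $H$, $\mathcal{H}$, $Q$ be as in the context. Let $D \subseteq \mathbb{R}^{S}$ be a non-empty set such that $H$ is increasing with respect to $\succeq_{D}$. Assume that $Q$ is $D$-preserving and $D$-decreasing. Assume moreover that at least one of the following two conditions holds: (i) $Q$ satisfies Property (C) and $\succeq_{D}$ is closed with respect to weak convergence; (ii) $Q$ satisfies Property (U) and $(\mathcal{P}(S),\succeq_{D})$ is a complete lattice. Then $Q$ has at most one invariant distribution, i.e. the operator $T$ has at most one fixed point in $\mathcal{P}(S)$.
   Context: $S$ is a Polish space with Borel $\sigma$-algebra $\mathcal{B}(S)$, endowed with a closed partial order $\geq$. $\mathcal{P}(S)$ is the set of Borel probability measures on $S$ with the weak topology ($\mu_n\to\mu$ weakly iff $\int f\,d\mu_n\to\int f\,d\mu$ for all bounded continuous $f$). $H:\mathcal{P}(S)\to\mathbb{R}$ is a measurable function (the aggregator) and $\mathcal{H}=\{H(\mu):\mu\in\mathcal{P}(S)\}$. Let $E$ be a Polish space, $\phi$ a probability measure on $E$, and $w:S\times\mathcal{H}\times E\to S$ measurable; the nonlinear Markov kernel is $Q(x,h,B)=\phi(\{\epsilon\in E: w(x,h,\epsilon)\in B\})$ for $x\in S$, $h\in\mathcal{H}$, $B\in\mathcal{B}(S)$ (this describes the chain $X_{t+1}=w(X_t,H(\mu_t),\epsilon_{t+1})$ with $\mu_t$ the law of $X_t$ and $\epsilon_t$ i.i.d. with law $\phi$). Define $T:\mathcal{P}(S)\to\mathcal{P}(S)$ by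 $T\mu(B)=\int_S Q(x,H(\mu),B)\,\mu(dx)$; $\mu$ is an invariant distribution of $Q$ if $T\mu=\mu$. For $h\in\mathcal{H}$, define $M_h:\mathcal{P}(S)\to\mathcal{P}(S)$ by $M_h\theta(B)=\int_S Q(x,h,B)\,\theta(dx)$, and $M_h^n$ its $n$-fold iterate. Stochastic order: for $D\subseteq\mathbb{R}^S$ and $\mu_1,\mu_2\in\mathcal{P}(S)$, write $\mu_2\succeq_D\mu_1$ if $\int f\,d\mu_2\ge\int f\,d\mu_1$ for all Borel measurable $f\in D$ for which the integrals exist. $\succeq_D$ is closed with respect to weak convergence if $\mu^1_n\succeq_D\mu^2_n$ for all $n$, $\mu^1_n\to\mu^1$ and $\mu^2_n\to\mu^2$ weakly imply $\mu^1\succeq_D\mu^2$. $H$ is increasing with respect to $\succeq_D$ if $\mu_2\succeq_D\mu_1$ implies $H(\mu_2)\ge H(\mu_1)$. Property (U): for every $h\in\mathcal{H}$, $M_h$ has a unique fixed point $\mu_h$. Property (C): Property (U) holds and, for every $h\in\mathcal{H}$ and every $\theta\in\mathcal{P}(S)$, $M_h^n\theta$ converges weakly to $\mu_h$ as $n\to\infty$. $Q$ is $D$-decreasing if for each $x\in S$ and $h_1,h_2\in\mathcal{H}$ with $h_2\ge h_1$, $Q(x,h_1,\cdot)\succeq_D Q(x,h_2,\cdot)$. $Q$ is $D$-preserving if for every $h\in\mathcal{H}$ and every $f\in D$, the function $v(x)=\int_S f(y)\,Q(x,h,dy)$ belongs to $D$. *)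

(* Defs.v *)
From HB Require Import structures.
From mathcomp Require Import all_boot all_order all_algebra.
From mathcomp Require Import all_classical all_reals all_analysis.
Set Implicit Arguments.
Unset Strict Implicit.
Unset Printing Implicit Defensive.
Import Order.TTheory GRing.Theory Num.Theory.
Import numFieldNormedType.Exports.
Local Open Scope classical_set_scope.
Local Open Scope ring_scope.

Definition polish (R : realType) (X : ptopologicalType) : Prop :=
  (exists A : set X, countable A /\ dense A) /\
  exists dist : X -> X -> R,
    [/\ ((forall x y, 0 <= dist x y) /\ (forall x y, dist x y = 0 <-> x = y)),
        (forall x y, dist x y = dist y x),
        (forall x y z, dist x z <= dist x y + dist y z),
        (forall A : set X, open A <->
           (forall x, A x -> exists2 e : R, 0 < e & [set y | dist x y < e] `<=` A))
      & (forall u : nat -> X,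
           (forall e : R, 0 < e -> exists N, forall m n, (N <= m)%N -> (N <= n)%N ->
               dist (u m) (u n) < e) ->
           exists l : X, u @ \oo --> l)].

Notation Borel X := (g_sigma_algebraType (@open X)).

Definition closed_partial_order (X : ptopologicalType) (ge : X -> X -> Prop) :=
  [/\ (forall x, ge x x), (forall x y, ge x y -> ge y x -> x = y),
      (forall x y z, ge x y -> ge y z -> ge x z)
    & closed [set p : X * X | ge p.1 p.2]].

Definition meq (X : ptopologicalType) (R : realType)
  (mu nu : set (Borel X) -> \bar R) : Prop :=
  forall B : set (Borel X), measurable B -> mu B = nu B.

Definition bounded_fun (X : Type) (R : realType) (f : X -> R) : Prop :=
  exists M : R, forall x, `|f x| <= M.

Definition Eint (X : ptopologicalType) (R : realType)
  (mu : set (Borel X) -> \bar R) (f : X -> R) : \bar R :=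
  (\int[mu]_x (f x)%:E)%E.

Definition weak_cvg (X : ptopologicalType) (R : realType)
  (mus : nat -> set (Borel X) -> \bar R) (mu : set (Borel X) -> \bar R) : Prop :=
  forall f : X -> R, continuous f -> bounded_fun f ->
    (fun n => Eint (mus n) f) @ \oo --> Eint mu f.

Definition weak_open (X : ptopologicalType) (R : realType)
  (O : set (probability (Borel X) R)) : Prop :=
  forall mu, O mu -> exists (n : nat) (fs : nat -> X -> R) (e : R),
    [/\ 0 < e, (forall i, (i < n)%N -> continuous (fs i) /\ bounded_fun (fs i))
      & [set nu : probability (Borel X) R | forall i, (i < n)%N ->
           `| fine (Eint nu (fs i)) - fine (Eint mu (fs i)) | < e] `<=` O].

Definition measurable_aggregator (X : ptopologicalType) (R : realType)
  (H : probability (Borel X) R -> R) : Prop :=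
  forall B : set R, measurable B -> <<s (@weak_open X R) >> (H @^-1` B).

(* measurability of w : S x calH x E -> S, where calH = range H carries the
   trace of the Borel sigma-algebra of R and S x R x E the product sigma-algebra *)
Definition measurable_law_of_motion (S E : ptopologicalType) (R : realType)
  (calH : set R) (w : S -> R -> E -> S) : Prop :=
  forall Y : set (Borel S), measurable Y ->
    exists A : set (Borel S * R * Borel E)%type, measurable A /\
      [set p : (Borel S * R * Borel E)%type | Y (w p.1.1 p.1.2 p.2) /\ calH p.1.2]
      = A `&` [set p | calH p.1.2].

Definition Qker (S E : ptopologicalType) (R : realType)
  (phi : probability (Borel E) R) (w : S -> R -> E -> S) (x : S) (h : R)
  : set (Borel S) -> \bar R :=
  fun B => phi (w x h @^-1` B).

Definition Mop (S E : ptopologicalType) (R : realType)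
  (phi : probability (Borel E) R) (w : S -> R -> E -> S) (h : R)
  (theta : set (Borel S) -> \bar R) : set (Borel S) -> \bar R :=
  fun B => (\int[theta]_x Qker phi w x h B)%E.

Definition Top (S E : ptopologicalType) (R : realType)
  (phi : probability (Borel E) R) (w : S -> R -> E -> S)
  (H : probability (Borel S) R -> R) (mu : probability (Borel S) R)
  : set (Borel S) -> \bar R :=
  Mop phi w (H mu) mu.

Definition invariant_distribution (S E : ptopologicalType) (R : realType)
  (phi : probability (Borel E) R) (w : S -> R -> E -> S)
  (H : probability (Borel S) R -> R) (mu : probability (Borel S) R) : Prop :=
  meq (Top phi w H mu) mu.

(* the integral of f w.r.t. mu exists (in the extended sense: not +oo - +oo) *)
Definition int_exists (X : ptopologicalType) (R : realType)
  (mu : set (Borel X) -> \bar R) (f : X -> R) : Prop :=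
  (Eint mu (fun x => Num.max (f x) 0%R) < +oo)%E \/
  (Eint mu (fun x => Num.max (- f x)%R 0%R) < +oo)%E.

Definition stoch_ge (X : ptopologicalType) (R : realType) (D : set (X -> R))
  (mu2 mu1 : set (Borel X) -> \bar R) : Prop :=
  forall f : X -> R, D f -> measurable_fun [set: Borel X] (f : Borel X -> R) ->
    int_exists mu2 f -> int_exists mu1 f ->
    (Eint mu1 f <= Eint mu2 f)%E.

Definition stoch_ge_closed (X : ptopologicalType) (R : realType) (D : set (X -> R))
  : Prop :=
  forall (mus1 mus2 : nat -> probability (Borel X) R)
         (mu1 mu2 : probability (Borel X) R),
    (forall n, stoch_ge D (mus1 n) (mus2 n)) ->
    weak_cvg (fun n => mus1 n) mu1 -> weak_cvg (fun n => mus2 n) mu2 ->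
    stoch_ge D mu1 mu2.

Definition H_increasing (X : ptopologicalType) (R : realType) (D : set (X -> R))
  (H : probability (Borel X) R -> R) : Prop :=
  forall mu1 mu2 : probability (Borel X) R, stoch_ge D mu2 mu1 -> H mu1 <= H mu2.

Definition complete_lattice_D (X : ptopologicalType) (R : realType) (D : set (X -> R))
  : Prop :=
  [/\ (forall mu : probability (Borel X) R, stoch_ge D mu mu),
      (forall mu nu rho : probability (Borel X) R,
          stoch_ge D mu nu -> stoch_ge D nu rho -> stoch_ge D mu rho),
      (forall mu nu : probability (Borel X) R,
          stoch_ge D mu nu -> stoch_ge D nu mu -> meq mu nu),
      (forall A : set (probability (Borel X) R), exists s : probability (Borel X) R,
          (forall a, A a -> stoch_ge D s a) /\
          (forall u : probability (Borel X) R,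
              (forall a, A a -> stoch_ge D u a) -> stoch_ge D u s))
    & (forall A : set (probability (Borel X) R), exists s : probability (Borel X) R,
          (forall a, A a -> stoch_ge D a s) /\
          (forall u : probability (Borel X) R,
              (forall a, A a -> stoch_ge D a u) -> stoch_ge D s u))].

Definition fixed_point_of_M (S E : ptopologicalType) (R : realType)
  (phi : probability (Borel E) R) (w : S -> R -> E -> S) (h : R)
  (mu : probability (Borel S) R) : Prop :=
  meq (Mop phi w h mu) mu.

Definition property_U (S E : ptopologicalType) (R : realType)
  (phi : probability (Borel E) R) (w : S -> R -> E -> S) (calH : set R) : Prop :=
  forall h, calH h ->
    (exists mu : probability (Borel S) R, fixed_point_of_M phi w h mu) /\
    (forall mu nu : probability (Borel S) R,
        fixed_point_of_M phi w h mu -> fixed_point_of_M phi w h nu -> meq mu nu).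

Definition property_C (S E : ptopologicalType) (R : realType)
  (phi : probability (Borel E) R) (w : S -> R -> E -> S) (calH : set R) : Prop :=
  property_U phi w calH /\
  forall h, calH h -> forall mu : probability (Borel S) R,
    fixed_point_of_M phi w h mu ->
    forall theta : probability (Borel S) R,
      weak_cvg (fun n => iter n (Mop phi w h) theta) mu.

Definition Q_decreasing (S E : ptopologicalType) (R : realType)
  (phi : probability (Borel E) R) (w : S -> R -> E -> S) (calH : set R)
  (D : set (S -> R)) : Prop :=
  forall x h1 h2, calH h1 -> calH h2 -> h1 <= h2 ->
    stoch_ge D (Qker phi w x h1) (Qker phi w x h2).

Definition Q_preserving (S E : ptopologicalType) (R : realType)
  (phi : probability (Borel E) R) (w : S -> R -> E -> S) (calH : set R)
  (D : set (S -> R)) : Prop :=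
  forall h, calH h -> forall f, D f ->
    D (fun x => fine (Eint (Qker phi w x h) f)).

(* Main.v *)
(** Let [mu1], [mu2] be invariant with [h1 = H mu1 <= h2 = H mu2]. Then [mu2] is
    the fixed point of [M_h2] and [M_h1 mu2] dominates [M_h2 mu2 = mu2] since [Q]
    is decreasing; if this propagates to the fixed point [mu1] of [M_h1], then
    [h2 <= h1] because [H] is increasing, so [h1 = h2] and Property (U) concludes.

    The difficulty is that elements of [D] may be unbounded: integrals may be
    infinite or undefined, the order [stoch_ge D] need not be transitive, and
    [fine] makes the hypothesis that [Q] preserves [D] vacuous where the integral
    is infinite.

    Under (i), [f] in [D] satisfies [int f dmu2 <= int f d(M_h1^n mu2)] as soon as
    it is integrable for all [M_h1^k mu2], [k <= n]. Mixing a small multiple of one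
    measure charging all of these into both sides makes every other [f] harmless,
    its integrals becoming infinite or undefined; weak limits do not see the
    mixing, so closedness gives the claim for [mu1] and [mu2].

    Under (ii), every measurable [f] in [D] is bounded: the top [s] is equivalent,
    hence equal, to its average with its conditional law on [{f <= N}], so that
    [f <= N] holds [s]-almost surely, and testing [s] against Dirac masses gives
    [f <= N] everywhere; dually for the bottom. Then [M_h1] is monotone and
    Tarski's argument produces a fixed point above [mu2]. *)
Require Import Defs.
From HB Require Import structures.
From mathcomp Require Import all_boot all_order all_algebra.
From mathcomp Require Import all_classical all_reals all_analysis.
From mathcomp Require Import measurable_realfun ring lra.
Import Order.TTheory GRing.Theory Num.Theory.
Import numFieldNormedType.Exports.
Local Open Scope classical_set_scope.
Local Open Scope ring_scope.

Set Implicit Arguments.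
Unset Strict Implicit.
Unset Printing Implicit Defensive.

(** * Integrals of signed functions: almost-everywhere comparison and change of variables *)

Section integral_facts.
Context {d : measure_display} {T : measurableType d} {R : realType}.
Local Open Scope ereal_scope.

Lemma ae_le_integral (mu : {measure set T -> \bar R}) (f g : T -> \bar R) :
  mu.-integrable setT f -> mu.-integrable setT g ->
  {ae mu, forall x, f x <= g x} -> \int[mu]_x f x <= \int[mu]_x g x.
Proof.
move=> intf intg fg.
have mf := measurable_int _ intf; have mg := measurable_int _ intg.
rewrite -sube_ge0; last by rewrite integrable_fin_num.
rewrite -integralB//.
(* Wherever [f] is finite and [f <= g], the difference equals its positive part, whose integral is
   nonnegative. *)
rewrite (ae_eq_integral (g \- f)^\+)//.
- exact: integral_ge0.
- exact: emeasurable_funB.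
- by apply: measurable_funepos; exact: emeasurable_funB.
have ffin := integrable_ae measurableT intf.
apply: filterS2 ffin fg => x /(_ I) fx fgx _.
by rewrite funeposE max_l// sube_ge0// fx.
Qed.

(** Positive and negative parts are transported separately, so infinite integrals are covered
    too. *)
Lemma integral_pushforwardE {d' : measure_display} {T' : measurableType d'}
    (mu : {measure set T' -> \bar R}) (phi : T' -> T) (f : T -> \bar R) :
  measurable_fun setT phi -> measurable_fun setT f ->
  \int[pushforward mu phi]_y f y = \int[mu]_x f (phi x).
Proof.
move=> mphi mf; rewrite [LHS]integralE [RHS]integralE.
congr (_ - _).
- rewrite ge0_integral_pushforward ?preimage_setT//=; last exact: measurable_funepos.
  by apply: eq_integral => x _; rewrite !funeposE.
- rewrite ge0_integral_pushforward ?preimage_setT//=; last exact: measurable_funeneg.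
  by apply: eq_integral => x _; rewrite !funenegE.
Qed.

Lemma integrable_pushforwardP {d' : measure_display} {T' : measurableType d'}
    (mu : {measure set T' -> \bar R}) (phi : T' -> T) (f : T -> \bar R) :
  measurable_fun setT phi ->
  (pushforward mu phi).-integrable setT f -> mu.-integrable setT (f \o phi).
Proof.
move=> mphi /integrableP[mf foo]; apply/integrableP; split.
  exact: measurableT_comp.
move: foo; rewrite (integral_pushforwardE _ _ (f := abse \o f))//.
exact: measurableT_comp.
Qed.

End integral_facts.

(** * Convex combinations of two probability measures *)

Section mixture.
Context {d : measure_display} {T : measurableType d} {R : realType}.
Variables (n : nat) (mu nu : probability T R).
Local Open Scope ereal_scope.

Let b : {nonneg R} := NngNum (harmonic_ge0 n).
Let a_ge0 : (0 <= 1 - harmonic n :> R)%R.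
Proof. by rewrite subr_ge0 invf_le1// ler1n. Qed.
Let a : {nonneg R} := NngNum a_ge0.

(** The weight [harmonic n] of [nu] is 1/(n+1): always positive, vanishing in the limit, and 1/2 at
    [n = 1]. At [n = 0] only [nu] remains. *)
Definition mixture : set T -> \bar R := measure_add (mscale a mu) (mscale b nu).

HB.instance Definition _ := Measure.on mixture.

Lemma mixtureE A :
  mixture A = (1 - harmonic n)%:E * mu A + (harmonic n)%:E * nu A.
Proof. by rewrite /mixture measure_addE. Qed.

Let mixture_setT : mixture setT = 1.
Proof. by rewrite mixtureE !probability_setT !mule1 -EFinD subrK. Qed.

HB.instance Definition _ := Measure_isProbability.Build _ _ _ mixture mixture_setT.

Lemma ge0_integral_mixture (f : T -> \bar R) :
  measurable_fun setT f -> (forall x, 0 <= f x) ->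
  \int[mixture]_x f x =
  (1 - harmonic n)%:E * \int[mu]_x f x + (harmonic n)%:E * \int[nu]_x f x.
Proof.
move=> mf f0; rewrite [LHS]ge0_integral_measure_add//.
by rewrite !ge0_integral_mscale.
Qed.

Lemma integral_mixture (f : T -> \bar R) :
  mu.-integrable setT f -> nu.-integrable setT f ->
  \int[mixture]_x f x =
  (1 - harmonic n)%:E * \int[mu]_x f x + (harmonic n)%:E * \int[nu]_x f x.
Proof.
move=> fmu fnu; have mf := measurable_int _ fmu.
rewrite integralE [\int[mu]_x f x]integralE [\int[nu]_x f x]integralE.
rewrite !ge0_integral_mixture//; [|exact: measurable_funeneg|exact: measurable_funepos].
(* All four parts are finite, which turns the identity into one between real numbers. *)
have /fineK <- := integrable_pos_fin_num measurableT fmu.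
have /fineK <- := integrable_neg_fin_num measurableT fmu.
have /fineK <- := integrable_pos_fin_num measurableT fnu.
have /fineK <- := integrable_neg_fin_num measurableT fnu.
by rewrite -!(EFinB, EFinM, EFinD); congr EFin; ring.
Qed.

Lemma ge0_integral_mixture_lty (f : T -> \bar R) :
  measurable_fun setT f -> (forall x, 0 <= f x) ->
  \int[mixture]_x f x < +oo -> \int[nu]_x f x < +oo.
Proof.
move=> mf f0; rewrite ge0_integral_mixture//.
apply: contraTT; rewrite -leNgt leye_eq => /eqP ->.
rewrite gt0_muley ?lte_fin ?harmonic_gt0// addey ?ltxx// -ltNye.
by rewrite (lt_le_trans ltNy0)// mule_ge0// ?lee_fin// integral_ge0.
Qed.

Lemma integrable_mixture_inv (f : T -> \bar R) : (0 < n)%N ->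
  mixture.-integrable setT f -> mu.-integrable setT f /\ nu.-integrable setT f.
Proof.
move=> n0 /integrableP[mf foo]; split; apply/integrableP; split => //; last first.
  apply: ge0_integral_mixture_lty foo => //; exact: measurableT_comp.
move: foo; rewrite (@ge0_integral_mixture (abse \o f));
  [|exact: measurableT_comp|by move=> x; exact: abse_ge0].
apply: contraTT; rewrite -leNgt leye_eq => /eqP ->.
have b1 : (harmonic n < 1 :> R)%R by rewrite invf_lt1 ?ltr1n.
rewrite gt0_muley ?lte_fin ?subr_gt0// addye ?ltxx// -ltNye.
rewrite (lt_le_trans ltNy0)// mule_ge0// ?lee_fin ?harmonic_ge0//.
by apply: integral_ge0 => x _; exact: abse_ge0.
Qed.

End mixture.

(** Nested averages give every [p k] with [k <= n] a positive weight, so integrability against this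
    one measure controls all of them. *)
Fixpoint mixtures {d : measure_display} {T : measurableType d} {R : realType}
    (p : nat -> probability T R) (n : nat) : probability T R :=
  if n is m.+1 then mixture 1 (mixtures p m) (p n) else p 0%N.

Lemma integrable_mixtures {d : measure_display} {T : measurableType d}
    {R : realType} (p : nat -> probability T R) (n k : nat) (f : T -> \bar R) :
  (k <= n)%N -> (mixtures p n).-integrable setT f -> (p k).-integrable setT f.
Proof.
elim: n => [|n ih]; first by rewrite leqn0 => /eqP ->.
rewrite leq_eqVlt => /orP[/eqP ->|kn] /integrable_mixture_inv[]// f1 f2.
exact: ih.
Qed.

(** * Possibly infinite integrals, the stochastic order and weak limits of mixtures *)

Section stochastic_order.
Context {X : ptopologicalType} {R : realType}.
Implicit Types (mu nu : {measure set (Borel X) -> \bar R}) (f : X -> R) (D : set (X -> R)).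
Local Open Scope ereal_scope.

Local Notation mfun f := (measurable_fun [set: Borel X] (f : Borel X -> R)).
Local Notation intble mu f :=
  (integrable mu [set: Borel X] (fun x : Borel X => (f x)%:E)).

Lemma Eint_meq mu nu f : meq mu nu -> Eint mu f = Eint nu f.
Proof. by move=> mn; apply: eq_measure_integral => A mA _; exact: mn. Qed.

Lemma int_existsE mu f : int_exists mu f <->
  \int[mu]_x (EFin \o f)^\+ x < +oo \/ \int[mu]_x (EFin \o f)^\- x < +oo.
Proof.
rewrite /int_exists /Eint.
under eq_integral do rewrite EFin_max.
under [X in _ \/ X < _ <-> _]eq_integral do rewrite EFin_max EFinN.
under [X in _ <-> X < _ \/ _]eq_integral do rewrite funeposE.
by under [X in _ <-> _ \/ X < _]eq_integral do rewrite funenegE.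
Qed.

Lemma integrable_posneg mu f : mfun f ->
  \int[mu]_x (EFin \o f)^\+ x < +oo -> \int[mu]_x (EFin \o f)^\- x < +oo ->
  intble mu f.
Proof.
move=> /measurable_EFinP mf fp fn; apply/integrableP; split => //.
under eq_integral do rewrite -/((abse \o (EFin \o f)) _) fune_abse.
rewrite ge0_integralD//; first exact: lte_add_pinfty.
- exact: measurable_funepos.
- exact: measurable_funeneg.
Qed.

Lemma integrable_int_exists mu f : intble mu f -> int_exists mu f.
Proof.
move=> fi; apply/int_existsE; left; exact: integral_funepos_lt_pinfty.
Qed.

Lemma integrable_dirac_EFin (x : X) f : mfun f -> intble (\d_(x : Borel X)) f.
Proof.
move=> /measurable_EFinP mf; apply/integrableP; split => //.
rewrite integral_dirac//; first by rewrite diracT mul1e ltry.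
exact: (measurableT_comp _ mf).
Qed.

Lemma Eint_dirac (x : X) f : mfun f -> Eint (\d_(x : Borel X)) f = (f x)%:E.
Proof.
by move=> /measurable_EFinP mf; rewrite /Eint integral_dirac// diracT mul1e.
Qed.

Lemma stoch_ge_meq D mu mu' nu nu' : meq mu mu' -> meq nu nu' ->
  stoch_ge D mu nu -> stoch_ge D mu' nu'.
Proof.
move=> mumu' nunu' ge f Df mf; rewrite /int_exists -!(Eint_meq _ mumu').
by rewrite -!(Eint_meq _ nunu'); exact: ge.
Qed.

Lemma bounded_integrable (mu : probability (Borel X) R) f (M : R) :
  mfun f -> (forall x, `|f x| <= M)%R -> intble mu f.
Proof.
move=> mf fM; apply: measurable_bounded_integrable => //.
- by rewrite [X in X < _](@probability_setT _ _ _ mu) ltry.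
- exists M; split; first exact: num_real.
  by move=> N MN x _ /=; exact: le_trans (fM x) (ltW MN).
Qed.

Lemma continuous_Borel_measurable f : continuous f -> mfun f.
Proof.
move=> /continuousP cf; apply: (measurability _ (RGenOpens.measurableE R)).
move=> _ [_ [a [b ->] <-]]; rewrite setTI; apply: sub_sigma_algebra.
exact/cf/interval_open.
Qed.

Lemma int_exists_posy mu f : int_exists mu f ->
  \int[mu]_x (EFin \o f)^\+ x = +oo -> Eint mu f = +oo.
Proof.
move=> /int_existsE[fp fpoo|fn fpoo]; first by rewrite fpoo in fp.
by rewrite /Eint integralE fpoo addye// -ltNye lteNr.
Qed.

Lemma int_exists_negy mu f : int_exists mu f ->
  \int[mu]_x (EFin \o f)^\- x = +oo -> Eint mu f = -oo.
Proof.
move=> /int_existsE[fp fnoo|fn fnoo]; last by rewrite fnoo in fn.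
by rewrite /Eint integralE fnoo addeNy// -ltey.
Qed.

Lemma integrable_meq mu nu f : meq mu nu -> intble mu f -> intble nu f.
Proof.
move=> mn /integrableP[mf foo]; apply/integrableP; split => //.
move: foo; congr (_ < _); apply: eq_measure_integral => A mA _; exact: mn.
Qed.

(* Only the [nu]-integrable elements of [D] matter: for the others, the integral
   of the left mixture is [+oo], that of the right one is [-oo], or one of them
   does not exist. *)
Lemma stoch_ge_mixture D (mu1 mu2 nu : probability (Borel X) R) n :
  (forall f, D f -> mfun f -> intble nu f ->
    [/\ intble mu1 f, intble mu2 f & Eint mu2 f <= Eint mu1 f]) ->
  stoch_ge D (mixture n mu1 nu) (mixture n mu2 nu).
Proof.
move=> le12 f Df mf ex1 ex2.
have mF : measurable_fun [set: Borel X] (EFin \o f) by exact/measurable_EFinP.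
have [fp|] := ltP (\int[nu]_x (EFin \o f)^\+ x) +oo; last first.
  rewrite leye_eq => /eqP fp; rewrite [leRHS]int_exists_posy ?leey//.
  apply/eqP; rewrite -leye_eq leNgt; apply/negP.
  move=> /ge0_integral_mixture_lty; rewrite fp ltxx => /(_ (measurable_funepos mF)).
  by move=> /(_ (funepos_ge0 _)).
have [fn|] := ltP (\int[nu]_x (EFin \o f)^\- x) +oo; last first.
  rewrite leye_eq => /eqP fn; rewrite [leLHS]int_exists_negy ?leNye//.
  apply/eqP; rewrite -leye_eq leNgt; apply/negP.
  move=> /ge0_integral_mixture_lty; rewrite fn ltxx => /(_ (measurable_funeneg mF)).
  by move=> /(_ (funeneg_ge0 _)).
have fnu := integrable_posneg mf fp fn.
have [f1 f2 f12] := le12 f Df mf fnu.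
rewrite /Eint !integral_mixture//; apply: leeD => //.
by apply: lee_wpmul2l => //; rewrite lee_fin subr_ge0 invf_le1// ler1n.
Qed.

(** Against a test function bounded by [M], mixing in [q n] moves the integral by at most 2M/(n+1),
    uniformly in the choice of [q n]. *)
Lemma weak_cvg_mixture (p q : nat -> probability (Borel X) R)
    (mu : probability (Borel X) R) :
  weak_cvg p mu -> weak_cvg (fun n => mixture n (p n) (q n)) mu.
Proof.
move=> pmu f cf bf; have := pmu f cf bf; case: bf => M fM.
have mf := continuous_Borel_measurable cf.
have fi (r : probability (Borel X) R) : intble r f by exact: bounded_integrable fM.
have fE (r : probability (Borel X) R) : Eint r f = (fine (Eint r f))%:E.
  by rewrite fineK// (integrable_fin_num _ (fi r)).
have fineM (r : probability (Borel X) R) : (`|fine (Eint r f)| <= M)%R.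
  suff : `|Eint r f| <= M%:E by rewrite fE lee_fin.
  have : `|Eint r f| <= \int[r]_x `|(f x)%:E|.
    by apply: le_abse_integral => //; exact/measurable_EFinP.
  move=> /le_trans; apply.
  have -> : M%:E = \int[r]_x (cst M%:E x) :> \bar R.
    by rewrite integral_cst// [X in _ * X](@probability_setT _ _ _ r) mule1.
  apply: ge0_le_integral => //; last by move=> x _; rewrite lee_fin.
  by apply: measurableT_comp => //; exact/measurable_EFinP.
under eq_fun do rewrite fE.
rewrite (fE mu) => /fine_cvgP[_ /= pcvg].
have -> : (fun n => Eint (mixture n (p n) (q n)) f) = (fun n =>
    (fine (Eint (p n) f) + harmonic n * (fine (Eint (q n) f) - fine (Eint (p n) f)))%:E).
  apply/funext => n; rewrite /Eint integral_mixture// -/(Eint _ f) -/(Eint _ f).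
  by rewrite (fE (p n)) (fE (q n)) -!EFinM -EFinD/=; congr EFin; ring.
apply: cvg_EFin; first exact: nearW.
rewrite -[X in _ --> X]addr0; apply: cvgD => //.
have b0 (c : R) : (fun n => harmonic n * c)%R @ \oo --> (0%R : R).
  by rewrite -[X in _ --> X](mul0r c); apply: cvgM; [exact: cvg_harmonic|exact: cvg_cst].
apply: (squeeze_cvgr _ (b0 (- (M + M))%R) (b0 (M + M)%R)).
apply: nearW => n; have := fineM (p n); have := fineM (q n).
rewrite !ler_norml => /andP[q1 q2] /andP[p1 p2].
by apply/andP; split; apply: ler_wpM2l; rewrite ?harmonic_ge0//; lra.
Qed.

End stochastic_order.

(** * One transition of the chain at a frozen aggregate [h] *)

Section transition.
Context {S E : ptopologicalType} {R : realType}.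
Variables (phi : probability (Borel E) R) (w : S -> R -> E -> S) (h : R).
Hypothesis mw :
  measurable_fun setT (fun p : Borel S * Borel E => w p.1 h p.2 : Borel S).
Local Open Scope ereal_scope.

Definition step (p : Borel S * Borel E) : Borel S := w p.1 h p.2.

Let mstep : measurable_fun setT step. Proof. exact: mw. Qed.

Let mfun_step : {mfun (Borel S * Borel E)%type >-> Borel S} :=
  HB.pack step (isMeasurableFun.Build _ _ _ _ _ mstep).

Let mstep1 (x : S) : measurable_fun setT (w x h : Borel E -> Borel S).
Proof. exact: (measurableT_comp mstep (pair1_measurable (x : Borel S))). Qed.

Lemma Eint_Qker (f : S -> R) (x : S) :
  measurable_fun [set: Borel S] (f : Borel S -> R) ->
  Eint (Qker phi w x h) f = fubini_F phi (EFin \o f \o step) x.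
Proof.
move=> /measurable_EFinP mf.
exact: (@integral_pushforwardE _ _ _ _ _ phi (w x h : Borel E -> Borel S) (EFin \o f)).
Qed.

Lemma integrable_Qker (f : S -> R) (x : S) :
  measurable_fun [set: Borel S] (f : Borel S -> R) ->
  phi.-integrable setT (fun e : Borel E => (f (w x h e))%:E) ->
  int_exists (Qker phi w x h) f.
Proof.
move=> mf fi.
pose X : {mfun Borel E >-> Borel S} :=
  HB.pack (w x h : Borel E -> Borel S) (isMeasurableFun.Build _ _ _ _ _ (@mstep1 x)).
apply: (@integrable_int_exists _ _ (distribution phi X)).
apply: (integrable_pushforward (mstep1 x)) => //.
exact/measurable_EFinP.
Qed.

Section transition_probability.
Variable theta : probability (Borel S) R.

(** The law of the next state when the current one has law [theta]; as a genuine probability measure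
    it can be iterated and is open to Fubini's theorem. *)
Definition ptransition : probability (Borel S) R :=
  distribution (theta \x phi : probability _ R) mfun_step.

(** The product measure integrates the [phi]-measure of sections, and the section of the preimage of
    [B] at [x] is the event defining [Qker]. *)
Lemma MopE : Mop phi w h theta = ptransition.
Proof.
apply/funext => B; rewrite /Mop /= /distribution /pushforward /= /product_measure1.
apply: eq_integral => x _ /=; congr (phi _).
by apply/seteqP; split => e; rewrite /xsection /= inE.
Qed.

Variable f : S -> R.
Hypothesis fi : integrable ptransition setT (fun x : Borel S => (f x)%:E).

Let mf : measurable_fun [set: Borel S] (f : Borel S -> R).
Proof. by apply/measurable_EFinP; exact: measurable_int fi. Qed.

Let fstep : (theta \x phi).-integrable setT (EFin \o f \o step).
Proof. exact: integrable_pushforwardP mstep fi. Qed.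

Let v (x : S) : R := fine (Eint (Qker phi w x h) f).

Let ae_v : {ae theta, forall x : Borel S, (v x)%:E = fubini_F phi (EFin \o f \o step) x}.
Proof.
have := integrable_ae measurableT (integrable_fubini_F fstep).
by apply: filterS => x /(_ I); rewrite /v Eint_Qker//; exact: fineK.
Qed.

Let mv : measurable_fun [set: Borel S] (fun x : Borel S => (v x)%:E).
Proof.
apply/measurable_EFinP.
have -> : v = fine \o fubini_F phi (EFin \o f \o step).
  by apply/funext => x; rewrite /v Eint_Qker.
exact: (measurableT_comp (fine_measurable measurableT) (measurable_fubini_F fstep)).
Qed.

Lemma integrable_Eint_Qker :
  theta.-integrable setT (fun x : Borel S => (v x)%:E).
Proof.
apply: le_integrable (integrable_fubini_F fstep) => // x _.
(* [fine] sends infinite values to 0, so it can only decrease the absolute value. *)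
by rewrite /v Eint_Qker//; case: fubini_F => [r||] /=; rewrite ?leey.
Qed.

(** Fubini moves the transition from the measure to the test function; the new test function is the
    one that [Q_preserving] keeps in [D]. *)
Lemma Eint_ptransition : Eint ptransition f = Eint theta v.
Proof.
transitivity (\int[theta]_x fubini_F phi (EFin \o f \o step) x).
  rewrite integral12_prod_meas1//.
  exact: (integral_pushforwardE _ mstep (measurable_int _ fi)).
apply: ae_eq_integral => //; first exact: measurable_fubini_F fstep.
by move: ae_v; apply: filterS => x -> _.
Qed.

(* Almost everywhere the integral is finite, so that [fine] loses nothing. *)
Lemma ae_int_exists_Qker : {ae theta, forall x : Borel S,
  int_exists (Qker phi w x h) f /\ Eint (Qker phi w x h) f = (v x)%:E}.
Proof.
move: ae_v (ae_integrable1 fstep); apply: filterS2 => x vx fx; split.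
  exact: integrable_Qker.
by rewrite vx Eint_Qker.
Qed.

End transition_probability.
End transition.

(** * Comparison of two frozen aggregates, and the weak limit under condition (i) *)

Section comparison.
Context {S E : ptopologicalType} {R : realType}.
Variables (phi : probability (Borel E) R) (w : S -> R -> E -> S).
Variables (calH : set R) (D : set (S -> R)).
Hypothesis dec : Q_decreasing phi w calH D.
Variables (h1 h2 : R).
Hypotheses (calH1 : calH h1) (calH2 : calH h2) (h12 : h1 <= h2).
Hypothesis mw1 :
  measurable_fun setT (fun p : Borel S * Borel E => w p.1 h1 p.2 : Borel S).
Hypothesis mw2 :
  measurable_fun setT (fun p : Borel S * Borel E => w p.1 h2 p.2 : Borel S).
Local Open Scope ereal_scope.

(** Integrability under both transitions makes the kernel integrals finite for almost every [x],
    where the decreasing property applies pointwise. *)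
Lemma Eint_ptransition_decreasing (theta : probability (Borel S) R) (f : S -> R) :
  D f -> integrable (ptransition phi mw1 theta) setT (fun x : Borel S => (f x)%:E) ->
  integrable (ptransition phi mw2 theta) setT (fun x : Borel S => (f x)%:E) ->
  Eint (ptransition phi mw2 theta) f <= Eint (ptransition phi mw1 theta) f.
Proof.
move=> Df f1 f2; have mf : measurable_fun [set: Borel S] (f : Borel S -> R).
  by apply/measurable_EFinP; exact: measurable_int f1.
rewrite !Eint_ptransition//; apply: ae_le_integral; try exact: integrable_Eint_Qker.
move: (ae_int_exists_Qker f1) (ae_int_exists_Qker f2); apply: filterS2.
move=> x [e1 <-] [e2 <-].
exact: (@dec x h1 h2).
Qed.

Variable mu2 : probability (Borel S) R.
Hypothesis fixed2 : fixed_point_of_M phi w h2 mu2.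
Hypothesis pres : Q_preserving phi w calH D.

Local Notation M1 := (ptransition phi mw1).
Local Notation intble mu f :=
  (integrable mu [set: Borel S] (fun x : Borel S => (f x)%:E)).

Let mu2E : meq (ptransition phi mw2 mu2) mu2.
Proof. by move=> B mB; rewrite -fixed2// MopE. Qed.

Lemma Eint_le_ptransition (f : S -> R) : D f -> intble mu2 f ->
  intble (M1 mu2) f -> Eint mu2 f <= Eint (M1 mu2) f.
Proof.
move=> Df f0 f1; rewrite -(Eint_meq f mu2E).
apply: Eint_ptransition_decreasing => //.
by apply: integrable_meq f0 => B mB; apply/esym/mu2E.
Qed.

(** The induction varies [f]: after one comparison, one transition on each side is absorbed into the
    test function, which stays in [D]. This avoids both transitivity and monotonicity of the
    order. *)
Lemma Eint_le_iter_ptransition n (f : S -> R) : D f ->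
  (forall k, (k <= n)%N -> intble (iter k M1 mu2) f) ->
  Eint mu2 f <= Eint (iter n M1 mu2) f.
Proof.
elim: n f => [//|n ih] f Df fk.
apply: (le_trans (Eint_le_ptransition Df (fk 0%N isT) (fk 1%N isT))).
rewrite iterS !Eint_ptransition//; [|exact: fk n.+1 _|exact: fk 1%N _].
apply: ih => [|k kn]; first exact: pres.
exact: integrable_Eint_Qker (fk k.+1 kn).
Qed.

Lemma iter_MopE n : iter n (Mop phi w h1) mu2 = iter n M1 mu2.
Proof. by elim: n => [//|n ih]; rewrite !iterS ih MopE. Qed.

Lemma stoch_ge_weak_limit (mu1 : probability (Borel S) R) :
  stoch_ge_closed D ->
  weak_cvg (fun n => iter n (Mop phi w h1) mu2) mu1 -> stoch_ge D mu1 mu2.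
Proof.
move=> cl mu2mu1; pose nu := mixtures (fun k => iter k M1 mu2).
(* A test function integrable against [nu n] is integrable along all iterates up to [n], the zeroth
   being [mu2] itself. *)
apply: (cl (fun n => mixture n (iter n M1 mu2) (nu n))
           (fun n => mixture n mu2 (nu n))).
- move=> n; apply: stoch_ge_mixture => f Df _ fnu.
  have fk k : (k <= n)%N -> intble (iter k M1 mu2) f.
    by move=> kn; exact: integrable_mixtures kn fnu.
  split; [exact: fk|exact: (fk 0%N)|exact: Eint_le_iter_ptransition].
- apply: weak_cvg_mixture; move: mu2mu1; congr (weak_cvg _ _).
  by apply/funext => n; exact: iter_MopE.
- by apply: weak_cvg_mixture => f _ _; exact: cvg_cst.
Qed.

End comparison.

(** On the slice at a fixed [h] in [calH] the trace restriction holds everywhere, so the preimage is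
    a section of the measurable set [A]. *)
Lemma measurable_law_of_motion_section {S E : ptopologicalType} {R : realType}
    (calH : set R) (w : S -> R -> E -> S) (h : R) :
  measurable_law_of_motion calH w -> calH h ->
  measurable_fun setT (fun p : Borel S * Borel E => w p.1 h p.2 : Borel S).
Proof.
move=> mw hh _ Y mY; rewrite setTI.
have [A [mA AE]] := mw Y mY.
have -> : (fun p : Borel S * Borel E => w p.1 h p.2 : Borel S) @^-1` Y =
    (fun p : Borel S * Borel E => ((p.1, h), p.2)) @^-1` A.
  apply/seteqP; split => -[x e] /= xeY.
    suff : (A `&` [set p | calH p.1.2]) (x, h, e) by case.
    by rewrite -AE.
  have : (A `&` [set p | calH p.1.2]) (x, h, e) by [].
  by rewrite -AE => -[].
rewrite -[X in measurable X]setTI.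
suff mg : measurable_fun setT (fun p : Borel S * Borel E => ((p.1, h), p.2)).
  exact: mg.
apply: measurable_fun_pair => /=; last exact: measurable_snd.
by apply: measurable_fun_pair => /=; first exact: measurable_fst.
Qed.

Lemma mnormalize_mrestr0 {d : measure_display} {T : measurableType d}
    {R : realType} (s : probability T R) (A : set T) (mA : measurable A) (B : set T) :
  s A != 0%E -> s (B `&` A) = 0%E -> mnormalize (mrestr s mA) s B = 0%E.
Proof.
move=> sA0 sBA; rewrite /mnormalize /=.
have -> : mrestr s mA setT = s A by rewrite /mrestr setTI.
(* [mnormalize] returns its second measure when the total mass is zero or infinite; both cases are
   excluded here. *)
rewrite (negbTE sA0) ifF; first by rewrite /mrestr sBA mul0e.
by apply/negbTE; rewrite -ltey -ge0_fin_numE// fin_num_measure.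
Qed.

(** * Boundedness of the measurable elements of [D] in a complete lattice *)

Section complete_lattice.
Context {X : ptopologicalType} {R : realType}.
Implicit Types (mu nu s : probability (Borel X) R) (f : X -> R) (D : set (X -> R)).
Local Open Scope ereal_scope.

Local Notation mfun f := (measurable_fun [set: Borel X] (f : Borel X -> R)).
Local Notation intble mu f :=
  (integrable mu [set: Borel X] (fun x : Borel X => (f x)%:E)).

Lemma measurable_le_cst f (c : R) : mfun f -> measurable [set x : Borel X | f x <= c]%R.
Proof.
move=> mf; have := mf measurableT _ (@measurable_itv _ `]-oo, c]).
by rewrite setTI.
Qed.

(** The sublevel sets cover the space, so by countable subadditivity they cannot all be null. *)
Lemma exists_le_measure_gt0 s f : mfun f ->
  exists n : nat, s [set x | f x <= n%:R]%R != 0.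
Proof.
move=> mf; apply: contrapT => /forallNP s0.
have : s setT <= 0.
  have -> : [set: Borel X] = \bigcup_n [set x | f x <= n%:R]%R.
    apply/esym/seteqP; split => // x _.
    by exists (Num.truncn (f x)).+1 => //=; exact: ltW (truncnS_gt _).
  have mA n : measurable [set x : Borel X | f x <= n%:R]%R.
    exact: measurable_le_cst.
  have := @measure_sigma_subadditive _ _ _ s _ _
    mA (bigcup_measurable (fun n _ => mA n)) (@subset_refl _ _).
  by rewrite eseries0// => n _ _; apply/eqP; move/negP: (s0 n); rewrite negbK.
by rewrite probability_setT lee_fin ler10.
Qed.

(** The function [c - f] is nonnegative with zero integral. *)
Lemma eq_sup_ae_eq s f (c : R) : mfun f -> (forall x, f x <= c)%R ->
  Eint s f = c%:E -> ae_eq s setT (EFin \o f) (cst c%:E).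
Proof.
move=> mf fc sfc.
have mF : measurable_fun [set: Borel X] (EFin \o f) by exact/measurable_EFinP.
have fi : intble s f.
  apply: integrable_posneg => //.
    apply: (@le_lt_trans _ _ (\int[s]_x (cst (maxe c%:E 0) x))); last first.
      by rewrite integral_cst// [X in _ * X](@probability_setT _ _ _ s) mule1 -EFin_max ltry.
    apply: ge0_le_integral => //; first exact: measurable_funepos.
    move=> x _; rewrite funeposE /= -!EFin_max lee_fin.
    by rewrite ge_max !le_max fc lexx orbT.
  (* Subtracting [+oo] from any extended real gives [-oo], which is not [c]. *)
  rewrite ltey; apply/eqP => fn; move: sfc; rewrite /Eint integralE fn.
  by case: (\int[s]_x _).
have ci : s.-integrable setT (cst c%:E) by exact: finite_measure_integrable_cst.
have : \int[s]_x `|(cst c%:E \- (EFin \o f)) x| = 0.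
  under eq_integral => x _ do rewrite gee0_abs ?sube_ge0 ?lee_fin//.
  rewrite integralB// [X in _ - X]sfc integral_cst//.
  by rewrite [X in _ * X](@probability_setT _ _ _ s) mule1 subee.
move=> /ae_eq_integral_abs -/(_ measurableT) H.
have /H : measurable_fun [set: Borel X] (cst c%:E \- (EFin \o f)).
  exact: emeasurable_funB.
move=> h; apply: filterS h => x /(_ I) /= /eqP.
by rewrite -EFinB eqe subr_eq0 => /eqP ->.
Qed.

Lemma top_bounded D s f :
  (forall mu nu, stoch_ge D mu nu -> stoch_ge D nu mu -> meq mu nu) ->
  (forall mu, stoch_ge D s mu) -> D f -> mfun f ->
  exists N : R, forall x, (f x <= N)%R.
Proof.
move=> antisym stop Df mf.
have [n sA0] := exists_le_measure_gt0 s mf; exists n%:R => y.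
set A := [set x | f x <= n%:R]%R in sA0.
have mA : measurable (A : set (Borel X)).
  exact: measurable_le_cst.
pose sA : probability (Borel X) R := mnormalize (mrestr s mA) s.
have sAE (B : set (Borel X)) : s (B `&` A) = 0 -> sA B = 0.
  exact: mnormalize_mrestr0.
(* Averaging with [s] keeps an infinite positive part infinite, which [sA] alone could lose. *)
pose t : probability (Borel X) R := mixture 1 sA s.
have tE0 (N : set (Borel X)) : measurable N -> s N = 0 -> t N = 0.
  move=> mN sN0; rewrite /t /= mixtureE sN0 mule0 adde0 sAE ?mule0//.
  by apply: subset_measure0 sN0 => //; exact: measurableI.
have le_top g : D g -> mfun g -> int_exists s g -> forall x, (g x)%:E <= Eint s g.
  move=> Dg mg exg x; rewrite -Eint_dirac//.
  apply: (stop (\d_(x : Borel X))) => //.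
  exact/integrable_int_exists/integrable_dirac_EFin.
have ts : stoch_ge D t s.
  (* If [int g ds] is finite it is the supremum of [g], so [g] is [s]-a.s., hence
     [t]-a.s., constant; otherwise the integral over [t] is not smaller. *)
  move=> g Dg mg ext exs.
  have mG : measurable_fun [set: Borel X] (EFin \o g) by exact/measurable_EFinP.
  have [gp|] := ltP (\int[s]_x (EFin \o g)^\+ x) +oo; last first.
    rewrite leye_eq => /eqP gp; rewrite [leRHS]int_exists_posy ?leey//.
    apply/eqP; rewrite -leye_eq leNgt; apply/negP.
    move=> /ge0_integral_mixture_lty; rewrite gp ltxx => /(_ (measurable_funepos mG)).
    by move=> /(_ (funepos_ge0 _)).
  have [gn|] := ltP (\int[s]_x (EFin \o g)^\- x) +oo; last first.
    by rewrite leye_eq => /eqP gn; rewrite [leLHS]int_exists_negy ?leNye.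
  have gi := integrable_posneg mg gp gn.
  have gE : Eint s g = (fine (Eint s g))%:E.
    by rewrite fineK// (integrable_fin_num _ gi).
  have /(eq_sup_ae_eq mg)/(_ gE) : forall x, (g x <= fine (Eint s g))%R.
    by move=> x; rewrite -lee_fin -gE; exact: le_top.
  move=> [N [mN sN0 gN]]; rewrite gE.
  have -> : Eint t g = \int[t]_x (cst (fine (Eint s g))%:E x).
    by apply: ae_eq_integral => //; exists N; split => //; exact: tE0.
  by rewrite integral_cst// [X in _ * X](@probability_setT _ _ _ t) mule1.
(* By antisymmetry [t] and [s] agree, yet outside [A] the mass of [t] is half that of [s]. *)
have sAC : s (~` A) = 0.
  have /= := antisym _ _ ts (stop t) (~` A) (measurableC mA).
  rewrite mixtureE sAE ?mule0 ?add0e; last by rewrite setICl measure0.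
  have /fineK <- : s (~` A) \is a fin_num by rewrite fin_num_measure//; exact: measurableC.
  by rewrite -EFinM => -[]; rewrite /harmonic => H; congr EFin; lra.
have mF : measurable_fun [set: Borel X] (EFin \o f) by exact/measurable_EFinP.
have fn : \int[s]_x (EFin \o f)^\+ x <= n%:R%:E.
  apply: (@le_trans _ _ (\int[s]_x (cst n%:R%:E x))); last first.
    by rewrite integral_cst// [X in _ * X](@probability_setT _ _ _ s) mule1.
  apply: ae_ge0_le_integral => //; first exact: measurable_funepos.
    by move=> x _; rewrite lee_fin ler0n.
  exists (~` A); split => //; first exact: measurableC.
  move=> x /= fx fxn; apply: fx => _.
  by rewrite funeposE /= -EFin_max lee_fin ge_max fxn ler0n.
have exf : int_exists s f.
  by apply/int_existsE; left; exact: le_lt_trans fn (ltry _).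
rewrite -lee_fin (le_trans (le_top f Df mf exf y))// /Eint integralE.
by apply: le_trans fn; rewrite geeDl// leeNl oppe0 integral_ge0.
Qed.

Lemma Eint_opp mu f : int_exists mu f ->
  Eint mu (fun x => - f x)%R = - Eint mu f.
Proof.
move=> /int_existsE ex; rewrite /Eint; under eq_integral do rewrite EFinN.
apply: integralN; case: ex => fo.
  by apply: fin_num_adde_defr; rewrite ge0_fin_numE// integral_ge0.
by apply: fin_num_adde_defl; rewrite fin_numN ge0_fin_numE// integral_ge0.
Qed.

Lemma int_exists_opp mu f : int_exists mu (fun x => - f x)%R <-> int_exists mu f.
Proof.
rewrite /int_exists.
under [Eint _ (fun x => Num.max (- - f x)%R 0%R)]eq_integral do rewrite opprK.
by split; case; [right|left|right|left].
Qed.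

(** Negating test functions exchanges top and bottom, so [top_bounded] also yields lower bounds. *)
Lemma stoch_ge_opp D mu nu : stoch_ge D mu nu ->
  stoch_ge [set f | D (fun x => - f x)%R] nu mu.
Proof.
move=> ge f /= Df mf exnu exmu.
have := ge _ Df (measurable_funN mf)
  ((int_exists_opp _ _).2 exmu) ((int_exists_opp _ _).2 exnu).
by rewrite !Eint_opp// leeN2.
Qed.
Lemma complete_lattice_integrable D mu f : complete_lattice_D D ->
  D f -> mfun f -> intble mu f.
Proof.
move=> [_ _ antisym hsup hinf] Df mf.
(* The supremum and infimum of all probability measures are the top and the bottom. *)
have [s [stop _]] := hsup setT; have [i [ibot _]] := hinf setT.
have [N fN] := top_bounded antisym (fun nu => stop nu I) Df mf.
pose DN := [set g : X -> R | D (fun x => - g x)%R].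
have DNN : [set g : X -> R | DN (fun x => - g x)%R] = D.
  apply/seteqP; split => g; rewrite /DN /=.
    by under eq_fun do rewrite opprK.
  by move=> Dg; under eq_fun do rewrite opprK.
have [] := @top_bounded DN i (fun x => - f x)%R.
- by move=> nu rho /stoch_ge_opp + /stoch_ge_opp; rewrite DNN => ge1 ge2; exact: antisym.
- by move=> nu; apply: stoch_ge_opp; exact: ibot.
- by rewrite /DN /=; under eq_fun do rewrite opprK.
- exact: measurable_funN.
move=> N' fN'; apply: (@bounded_integrable _ _ _ _ (`|N| + `|N'|)%R) => // x.
rewrite ler_norml; apply/andP; split.
  rewrite lerNl (le_trans (fN' x))// (le_trans (ler_norm _))// lerDr//.
by rewrite (le_trans (fN x))// (le_trans (ler_norm _))// lerDl.
Qed.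

End complete_lattice.

(** * Tarski's argument under condition (ii) *)

Lemma complete_lattice_stoch_ge {S E : ptopologicalType} {R : realType}
    (phi : probability (Borel E) R) (w : S -> R -> E -> S)
    (calH : set R) (D : set (S -> R)) (h1 h2 : R)
    (mu1 mu2 : probability (Borel S) R) :
  Q_decreasing phi w calH D -> Q_preserving phi w calH D ->
  property_U phi w calH -> complete_lattice_D D ->
  calH h1 -> calH h2 -> h1 <= h2 ->
  measurable_fun setT (fun p : Borel S * Borel E => w p.1 h1 p.2 : Borel S) ->
  measurable_fun setT (fun p : Borel S * Borel E => w p.1 h2 p.2 : Borel S) ->
  fixed_point_of_M phi w h1 mu1 -> fixed_point_of_M phi w h2 mu2 ->
  stoch_ge D mu1 mu2.
Proof.
move=> dec pres U lat calH1 calH2 h12 mw1 mw2 fixed1 fixed2.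
have Dint mu f Df mf := @complete_lattice_integrable _ _ D mu f lat Df mf.
have [refl trans antisym hsup _] := lat.
pose M1 := ptransition phi mw1.
have M1mono (th th' : probability (Borel S) R) :
    stoch_ge D th th' -> stoch_ge D (M1 th) (M1 th').
  move=> ge f Df mf _ _; have fi := Dint (M1 th) f Df mf.
  have fi' := Dint (M1 th') f Df mf.
  rewrite /M1 !Eint_ptransition//.
  have vi := integrable_Eint_Qker fi; have vi' := integrable_Eint_Qker fi'.
  apply: ge; [exact: pres| |exact: integrable_int_exists..].
  by apply/measurable_EFinP; exact: measurable_int vi.
(* The measures that [M1] moves upwards; their supremum will be a fixed point. *)
pose A := [set th : probability (Borel S) R | stoch_ge D (M1 th) th].
have [s [sub slub]] := hsup A.
have As : stoch_ge D (M1 s) s.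
  apply: slub => th Ath; apply: (trans _ (M1 th)) => //.
  exact/M1mono/sub.
(* By monotonicity [M1 s] lies in [A] as well, hence below [s]. *)
have fixs : fixed_point_of_M phi w h1 s.
  rewrite /fixed_point_of_M (MopE phi mw1); apply: antisym => //.
  by apply: sub; exact: M1mono.
have mu1s : meq s mu1 by exact: (U h1 calH1).2.
apply: (@stoch_ge_meq _ _ _ s mu1 mu2 mu2) => //.
(* It remains that [mu2] belongs to [A], which is where the decreasing kernel enters. *)
apply: sub => f Df mf _ _.
exact: (Eint_le_ptransition dec calH1 calH2 h12 mw2 fixed2 Df
  (Dint _ f Df mf) (Dint _ f Df mf)).
Qed.

(** * Uniqueness of the invariant distribution *)

Theorem theorem1 (R : realType) (S : ptopologicalType) (geS : S -> S -> Prop)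
  (H : probability (Borel S) R -> R)
  (E : ptopologicalType) (phi : probability (Borel E) R) (w : S -> R -> E -> S)
  (D : set (S -> R)) :
  polish R S -> closed_partial_order geS ->
  measurable_aggregator H ->
  polish R E -> measurable_law_of_motion (range H) w ->
  D !=set0 -> H_increasing D H ->
  Q_preserving phi w (range H) D -> Q_decreasing phi w (range H) D ->
  ((property_C phi w (range H) /\ stoch_ge_closed D) \/
   (property_U phi w (range H) /\ complete_lattice_D D)) ->
  forall mu1 mu2 : probability (Borel S) R,
    invariant_distribution phi w H mu1 -> invariant_distribution phi w H mu2 -> meq mu1 mu2.
Proof.
move=> _ _ _ _ mw _ Hinc pres dec cond.
have U : property_U phi w (range H) by case: cond => [[[]]|[]].
have calH mu : range H (H mu) by exists mu.
have mwH mu := measurable_law_of_motion_section mw (calH mu).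
(* An invariant distribution is a fixed point of the operator frozen at its own aggregate; the
   smaller aggregate yields the dominating fixed point. *)
have le mu1 mu2 : invariant_distribution phi w H mu1 ->
    invariant_distribution phi w H mu2 -> H mu1 <= H mu2 -> H mu2 <= H mu1.
  move=> fixed1 fixed2 h12; apply: Hinc.
  case: cond => [[[_ C] cl]|[_ lat]].
    apply: (stoch_ge_weak_limit dec (calH mu1) (calH mu2) h12
      (mwH mu1) (mwH mu2) fixed2 pres cl).
    exact: C (calH mu1) _ fixed1 _.
  exact: (complete_lattice_stoch_ge dec pres U lat (calH mu1) (calH mu2) h12
      (mwH mu1) (mwH mu2) fixed1 fixed2).
move=> mu1 mu2 fixed1 fixed2.
have H12 : H mu1 = H mu2.
  have [h|h] := leP (H mu1) (H mu2); apply: le_anti.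
    by rewrite h (le mu1 mu2).
  by rewrite (ltW h) (le mu2 mu1)// ltW.
(* With equal aggregates both measures are fixed by the same operator. *)
apply: (U _ (calH mu1)).2 => //.
by move: fixed2; rewrite /invariant_distribution /Top -H12.
Qed.
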